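(* Let $\mathbb{X}$ be a differential category with differential modality $(\mathsf{S},\mu,\eta,\mathsf{m},\mathsf{u},\mathsf{d})$. Then $(\overline{\mathsf{S}},\overline{\mu},\overline{\eta})$ is a monad on the arrow category $\mathsf{Arr}[\mathbb{X}]$, where: \begin{itemize} \item $\overline{\mathsf{S}}(\phi\colon A_0\to A_1)=\big((1_{\mathsf{S}(A_0)}\otimes\phi)\circ\mathsf{d}_{A_0}\colon \mathsf{S}(A_0)\to \mathsf{S}(A_0)\otimes A_1\big)$ on objects and $\overline{\mathsf{S}}(f_0,f_1)=(\mathsf{S}(f_0),\mathsf{S}(f_0)\otimes f_1)$ on maps; \item the unit is $\overline{\eta}_{\phi}=(\eta_{A_0},\ \mathsf{u}_{A_0}\otimes 1_{A_1})$; \item the multiplication is $\overline{\mu}_{\phi}=\big(\mu_{A_0},\ (\mathsf{m}_{A_0}\otimes 1_{A_1})\circ(\mu_{A_0}\otimes 1_{\mathsf{S}(A_0)}\otimes 1_{A_1})\big)$, with second component of type $\mathsf{S}\mathsf{S}(A_0)\otimes\mathsf{S}(A_0)\otimes A_1\to\mathsf{S}(A_0)\otimes A_1$. \end{itemize}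
   Context: Symmetric monoidal categories $(\mathbb{X},\otimes,I)$ are written as strict (associators and unitors treated as identities), with symmetry $\sigma_{A,B}\colon A\otimes B\to B\otimes A$. An additive category is a category enriched over commutative monoids: each hom-set is a commutative monoid $(+,0)$ and composition preserves $+$ and $0$ in each argument (no negatives or biproducts assumed). An additive symmetric monoidal category is a symmetric monoidal category that is additive and such that $\otimes$ of maps preserves $+$ and $0$ in each argument. An algebra modality on a symmetric monoidal category is $(\mathsf{S},\mu,\eta,\mathsf{m},\mathsf{u})$ where $(\mathsf{S},\mu,\eta)$ is a monad ($\mu_A\colon\mathsf{S}\mathsf{S}(A)\to\mathsf{S}(A)$, $\eta_A\colon A\to\mathsf{S}(A)$) and $\mathsf{m}_A\colon\mathsf{S}(A)\otimes\mathsf{S}(A)\to\mathsf{S}(A)$, $\mathsf{u}_A\colon I\to\mathsf{S}(A)$ are natural transformations such that each $(\mathsf{S}(A),\mathsf{m}_A,\mathsf{u}_A)$ is a commutative monoid and each $\mu_A$ is a monoid morphism $(\mathsf{S}\mathsf{S}(A),\mathsf{m}_{\mathsf{S}(A)},\mathsf{u}_{\mathsf{S}(A)})\to(\mathsf{S}(A),\mathsf{m}_A,\mathsf{u}_A)$. A differential modality on an additive symmetric monoidal category is an algebra modality with a natural transformation $\mathsf{d}_A\colon\mathsf{S}(A)\to\mathsf{S}(A)\otimes A$ (the deriving transformation) such that [D.1] $\mathsf{d}_A\circ\mathsf{u}_A=0$; [D.2] $\mathsf{d}_A\circ\mathsf{m}_A=(\mathsf{m}_A\otimes 1_A)\circ\big((1_{\mathsf{S}(A)}\otimes\mathsf{d}_A)+(1_{\mathsf{S}(A)}\otimes\sigma_{A,\mathsf{S}(A)})\circ(\mathsf{d}_A\otimes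 1_{\mathsf{S}(A)})\big)$; [D.3] $\mathsf{d}_A\circ\eta_A=\mathsf{u}_A\otimes 1_A$; [D.4] $\mathsf{d}_A\circ\mu_A=(\mathsf{m}_A\otimes 1_A)\circ(\mu_A\otimes\mathsf{d}_A)\circ\mathsf{d}_{\mathsf{S}(A)}$; [D.5] $(1_{\mathsf{S}(A)}\otimes\sigma_{A,A})\circ(\mathsf{d}_A\otimes 1_A)\circ\mathsf{d}_A=(\mathsf{d}_A\otimes 1_A)\circ\mathsf{d}_A$. A differential category is an additive symmetric monoidal category equipped with a differential modality. The arrow category $\mathsf{Arr}[\mathbb{X}]$ has as objects the maps $\phi\colon A_0\to A_1$ of $\mathbb{X}$ and as maps $\phi\to\phi'$ the pairs $(f_0\colon A_0\to A_0',\ f_1\colon A_1\to A_1')$ with $f_1\circ\phi=\phi'\circ f_0$; composition and identities are componentwise. *)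

(* Defs.v *)
From Stdlib Require Import ProofIrrelevance.
From mathcomp Require Import ssreflect ssrfun.

Set Implicit Arguments.
Unset Strict Implicit.
Unset Printing Implicit Defensive.

Declare Scope cat_scope.
Delimit Scope cat_scope with cat.
Local Open Scope cat_scope.

Record category := Category {
  ob :> Type;
  hom : ob -> ob -> Type;
  idm : forall A, hom A A;
  comp : forall A B C, hom B C -> hom A B -> hom A C;
  compA : forall A B C D (h : hom C D) (g : hom B C) (f : hom A B),
    comp h (comp g f) = comp (comp h g) f;
  comp1m : forall A B (f : hom A B), comp (idm B) f = f;
  compm1 : forall A B (f : hom A B), comp f (idm A) = f
}.

Arguments hom {c} A B.
Arguments idm {c} A.
Arguments comp {c A B C} g f : rename.

Notation "g ∘ f" := (comp g f) (at level 40, left associativity) : cat_scope.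

Definition is_functor (C D : category) (F0 : C -> D)
    (F1 : forall A B : C, hom A B -> hom (F0 A) (F0 B)) : Prop :=
  (forall A : C, F1 A A (idm A) = idm (F0 A)) /\
  (forall (A B E : C) (g : hom B E) (f : hom A B),
     F1 A E (g ∘ f) = F1 B E g ∘ F1 A B f).

Definition is_natural (C D : category)
    (F0 : C -> D) (F1 : forall A B : C, hom A B -> hom (F0 A) (F0 B))
    (G0 : C -> D) (G1 : forall A B : C, hom A B -> hom (G0 A) (G0 B))
    (alpha : forall A : C, hom (F0 A) (G0 A)) : Prop :=
  forall (A B : C) (f : hom A B), alpha B ∘ F1 A B f = G1 A B f ∘ alpha A.

Record is_monad (C : category)
    (T0 : C -> C) (T1 : forall A B : C, hom A B -> hom (T0 A) (T0 B))
    (mu : forall A : C, hom (T0 (T0 A)) (T0 A))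
    (eta : forall A : C, hom A (T0 A)) : Prop := IsMonad {
  monad_functor : is_functor T1;
  monad_mu_natural :
    is_natural (fun A B f => T1 (T0 A) (T0 B) (T1 A B f)) T1 mu;
  monad_eta_natural : is_natural (fun A B f => f) T1 eta;
  monad_assoc : forall A, mu A ∘ T1 _ _ (mu A) = mu A ∘ mu (T0 A);
  monad_unitl : forall A, mu A ∘ eta (T0 A) = idm (T0 A);
  monad_unitr : forall A, mu A ∘ T1 _ _ (eta A) = idm (T0 A)
}.

(* Monoidal categories are not assumed strict: equality of objects is
   unusable for typing composites, so the coherence isomorphisms, which are
   traditionally suppressed, are explicit in every formula below. *)
Record monoidal_data (C : category) := MonoidalData {
  tens : C -> C -> C;
  tensm : forall A B A' B' : C,
    hom A A' -> hom B B' -> hom (tens A B) (tens A' B');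
  unito : C;
  assoc : forall A B E, hom (tens (tens A B) E) (tens A (tens B E));
  associ : forall A B E, hom (tens A (tens B E)) (tens (tens A B) E);
  lunit : forall A, hom (tens unito A) A;
  luniti : forall A, hom A (tens unito A);
  runit : forall A, hom (tens A unito) A;
  runiti : forall A, hom A (tens A unito);
  symm : forall A B, hom (tens A B) (tens B A)
}.

Record is_symmetric_monoidal (C : category) (M : monoidal_data C) : Prop :=
    IsSymmetricMonoidal {
  tensm_id : forall A B, tensm M (idm A) (idm B) = idm (tens M A B);
  tensm_comp : forall A B A' B' A'' B'' (f' : hom A' A'') (f : hom A A')
      (g' : hom B' B'') (g : hom B B'),
    tensm M (f' ∘ f) (g' ∘ g) = tensm M f' g' ∘ tensm M f g;
  assoc_natural : forall A B E A' B' E'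
      (f : hom A A') (g : hom B B') (h : hom E E'),
    assoc M A' B' E' ∘ tensm M (tensm M f g) h =
    tensm M f (tensm M g h) ∘ assoc M A B E;
  lunit_natural : forall A B (f : hom A B),
    lunit M B ∘ tensm M (idm (unito M)) f = f ∘ lunit M A;
  runit_natural : forall A B (f : hom A B),
    runit M B ∘ tensm M f (idm (unito M)) = f ∘ runit M A;
  symm_natural : forall A B A' B' (f : hom A A') (g : hom B B'),
    symm M A' B' ∘ tensm M f g = tensm M g f ∘ symm M A B;
  assocK : forall A B E, associ M A B E ∘ assoc M A B E = idm _;
  associK : forall A B E, assoc M A B E ∘ associ M A B E = idm _;
  lunitK : forall A, luniti M A ∘ lunit M A = idm _;
  lunitiK : forall A, lunit M A ∘ luniti M A = idm _;
  runitK : forall A, runiti M A ∘ runit M A = idm _;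
  runitiK : forall A, runit M A ∘ runiti M A = idm _;
  symmK : forall A B, symm M B A ∘ symm M A B = idm _;
  pentagon : forall A B E F,
    assoc M A B (tens M E F) ∘ assoc M (tens M A B) E F =
    tensm M (idm A) (assoc M B E F) ∘ assoc M A (tens M B E) F
      ∘ tensm M (assoc M A B E) (idm F);
  triangle : forall A B,
    tensm M (idm A) (lunit M B) ∘ assoc M A (unito M) B =
    tensm M (runit M A) (idm B);
  hexagon : forall A B E,
    assoc M B E A ∘ symm M A (tens M B E) ∘ assoc M A B E =
    tensm M (idm B) (symm M A E) ∘ assoc M B A E
      ∘ tensm M (symm M A B) (idm E)
}.

Record symmetric_monoidal_category := SymmetricMonoidalCategory {
  smc_category :> category;
  smc_data : monoidal_data smc_category;
  smc_laws : is_symmetric_monoidal smc_data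
}.

Notation "A ⊗ B" := (tens (smc_data _) A B)
  (at level 35, right associativity) : cat_scope.
Notation "f ⊠ g" := (tensm (smc_data _) f g)
  (at level 35, right associativity) : cat_scope.
Notation α := (assoc (smc_data _)).
Notation αi := (associ (smc_data _)).
Notation λu := (lunit (smc_data _)).
Notation λui := (luniti (smc_data _)).
Notation ρu := (runit (smc_data _)).
Notation σ := (symm (smc_data _)).
Notation II X := (unito (smc_data X)).

Record is_commutative_monoid (X : symmetric_monoidal_category) (A : X)
    (m : hom (A ⊗ A) A) (u : hom (II X) A) : Prop := IsCommutativeMonoid {
  monoid_assoc : m ∘ (m ⊠ idm A) = m ∘ (idm A ⊠ m) ∘ α A A A;
  monoid_unitl : m ∘ (u ⊠ idm A) = λu A;
  monoid_unitr : m ∘ (idm A ⊠ u) = ρu A;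
  monoid_comm : m ∘ σ A A = m
}.

Definition is_monoid_morphism (X : symmetric_monoidal_category) (A B : X)
    (mA : hom (A ⊗ A) A) (uA : hom (II X) A)
    (mB : hom (B ⊗ B) B) (uB : hom (II X) B) (f : hom A B) : Prop :=
  f ∘ mA = mB ∘ (f ⊠ f) /\ f ∘ uA = uB.

Record additive_structure (C : category) := AdditiveStructure {
  addm : forall A B : C, hom A B -> hom A B -> hom A B;
  zerom : forall A B : C, hom A B;
  addmA : forall A B, associative (@addm A B);
  addmC : forall A B, commutative (@addm A B);
  add0m : forall A B, left_id (zerom A B) (@addm A B);
  comp_addl : forall A B E (g g' : hom B E) (f : hom A B),
    addm g g' ∘ f = addm (g ∘ f) (g' ∘ f);
  comp_addr : forall A B E (g : hom B E) (f f' : hom A B),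
    g ∘ addm f f' = addm (g ∘ f) (g ∘ f');
  comp_0l : forall A B E (f : hom A B), zerom B E ∘ f = zerom A E;
  comp_0r : forall A B E (g : hom B E), g ∘ zerom A B = zerom A E
}.

Record additive_smc := AdditiveSMC {
  asmc_smc :> symmetric_monoidal_category;
  asmc_add : additive_structure asmc_smc;
  tensm_addl : forall (A B A' B' : asmc_smc) (f f' : hom A A') (g : hom B B'),
    addm asmc_add f f' ⊠ g = addm asmc_add (f ⊠ g) (f' ⊠ g);
  tensm_addr : forall (A B A' B' : asmc_smc) (f : hom A A') (g g' : hom B B'),
    f ⊠ addm asmc_add g g' = addm asmc_add (f ⊠ g) (f ⊠ g');
  tensm_0l : forall (A B A' B' : asmc_smc) (g : hom B B'),
    zerom asmc_add A A' ⊠ g = zerom asmc_add (A ⊗ B) (A' ⊗ B');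
  tensm_0r : forall (A B A' B' : asmc_smc) (f : hom A A'),
    f ⊠ zerom asmc_add B B' = zerom asmc_add (A ⊗ B) (A' ⊗ B')
}.

Notation "f +m g" := (addm (asmc_add _) f g)
  (at level 50, left associativity) : cat_scope.
Notation zero A B := (zerom (asmc_add _) A B).

Record algebra_modality (X : symmetric_monoidal_category) := AlgebraModality {
  S0 :> X -> X;
  S1 : forall A B : X, hom A B -> hom (S0 A) (S0 B);
  muS : forall A : X, hom (S0 (S0 A)) (S0 A);
  etaS : forall A : X, hom A (S0 A);
  mS : forall A : X, hom (S0 A ⊗ S0 A) (S0 A);
  uS : forall A : X, hom (II X) (S0 A);
  S_monad : is_monad S1 muS etaS;
  mS_natural : is_natural (fun A B f => S1 f ⊠ S1 f) S1 mS;
  uS_natural : is_natural (fun A B f => idm (II X)) S1 uS;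
  S_monoid : forall A, is_commutative_monoid (mS A) (uS A);
  muS_morphism : forall A,
    is_monoid_morphism (mS (S0 A)) (uS (S0 A)) (mS A) (uS A) (muS A)
}.

Record is_deriving_transformation (X : additive_smc) (S : algebra_modality X)
    (d : forall A : X, hom (S A) (S A ⊗ A)) : Prop :=
    IsDerivingTransformation {
  deriving_natural : is_natural (S1 S) (fun A B f => S1 S f ⊠ f) d;
  deriving_constant : forall A, d A ∘ uS S A = zero (II X) (S A ⊗ A);
  deriving_product : forall A,
    d A ∘ mS S A =
    (mS S A ⊠ idm A) ∘ αi (S A) (S A) A
      ∘ ((idm (S A) ⊠ d A)
         +m (idm (S A) ⊠ σ A (S A)) ∘ α (S A) A (S A) ∘ (d A ⊠ idm (S A)));
  deriving_linear : forall A, d A ∘ etaS S A = (uS S A ⊠ idm A) ∘ λui A;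
  deriving_chain : forall A,
    d A ∘ muS S A =
    (mS S A ⊠ idm A) ∘ αi (S A) (S A) A ∘ (muS S A ⊠ d A) ∘ d (S A);
  deriving_interchange : forall A,
    (idm (S A) ⊠ σ A A) ∘ α (S A) A A ∘ (d A ⊠ idm A) ∘ d A =
    α (S A) A A ∘ (d A ⊠ idm A) ∘ d A
}.

Record differential_modality (X : additive_smc) := DifferentialModality {
  dm_algebra :> algebra_modality X;
  dS : forall A : X, hom (dm_algebra A) (dm_algebra A ⊗ A);
  dS_deriving : is_deriving_transformation dS
}.

Record arrow (C : category) := Arrow {
  adom : C;
  acod : C;
  amap :> hom adom acod
}.

Definition is_square (C : category) (φ ψ : arrow C)
    (f : hom (adom φ) (adom ψ) * hom (acod φ) (acod ψ)) : Prop :=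
  f.2 ∘ φ = ψ ∘ f.1.

Record arrow_hom (C : category) (φ ψ : arrow C) := ArrowHom {
  apair :> hom (adom φ) (adom ψ) * hom (acod φ) (acod ψ);
  asquare : is_square apair
}.

Lemma arrow_hom_eq (C : category) (φ ψ : arrow C) (f g : arrow_hom φ ψ) :
  apair f = apair g -> f = g.
Proof.
case: f g => [f Hf] [g Hg] /= E; case: _ / E Hg => Hg.
by rewrite (proof_irrelevance _ Hf Hg).
Qed.

Lemma idm_square (C : category) (φ : arrow C) :
  @is_square C φ φ (idm (adom φ), idm (acod φ)).
Proof. by rewrite /is_square /= comp1m compm1. Qed.

Lemma comp_square (C : category) (φ ψ χ : arrow C)
    (g : arrow_hom ψ χ) (f : arrow_hom φ ψ) :
  @is_square C φ χ (g.1 ∘ f.1, g.2 ∘ f.2).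
Proof.
rewrite /is_square /= -compA (asquare f) compA (asquare g) compA.
by [].
Qed.

Definition Arr (C : category) : category.
Proof.
refine (@Category (arrow C) (@arrow_hom C)
  (fun φ => ArrowHom (idm_square φ))
  (fun φ ψ χ g f => ArrowHom (comp_square g f)) _ _ _).
- by move=> *; apply: arrow_hom_eq; rewrite /= !compA.
- by move=> φ ψ [[f0 f1] Hf]; apply: arrow_hom_eq; rewrite /= !comp1m.
- by move=> φ ψ [[f0 f1] Hf]; apply: arrow_hom_eq; rewrite /= !compm1.
Defined.

Definition Sbar (X : additive_smc) (S : differential_modality X)
    (φ : Arr X) : Arr X :=
  @Arrow X (S (adom φ)) (S (adom φ) ⊗ acod φ)
    ((idm (S (adom φ)) ⊠ amap φ) ∘ dS S (adom φ)).

Definition Sbar_map (X : additive_smc) (S : differential_modality X)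
    (φ ψ : Arr X) (f : hom φ ψ) :
    hom (adom (Sbar S φ)) (adom (Sbar S ψ)) * hom (acod (Sbar S φ)) (acod (Sbar S ψ)) :=
  (S1 S f.1, S1 S f.1 ⊠ f.2).

Definition etabar (X : additive_smc) (S : differential_modality X)
    (φ : Arr X) :
    hom (adom φ) (adom (Sbar S φ)) * hom (acod φ) (acod (Sbar S φ)) :=
  (etaS S (adom φ), (uS S (adom φ) ⊠ idm (acod φ)) ∘ λui (acod φ)).

Definition mubar (X : additive_smc) (S : differential_modality X)
    (φ : Arr X) :
    hom (adom (Sbar S (Sbar S φ))) (adom (Sbar S φ)) *
    hom (acod (Sbar S (Sbar S φ))) (acod (Sbar S φ)) :=
  (muS S (adom φ),
   (mS S (adom φ) ⊠ idm (acod φ))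
     ∘ αi (S (adom φ)) (S (adom φ)) (acod φ)
     ∘ (muS S (adom φ) ⊠ (idm (S (adom φ)) ⊠ idm (acod φ)))).

(* Main.v *)
From mathcomp Require Import ssreflect ssrfun.
Require Import Defs.

Set Implicit Arguments.
Unset Strict Implicit.
Unset Printing Implicit Defensive.

Local Open Scope cat_scope.

(* For a commutative monoid (A, m, u), the map (m ⊗ 1) ∘ αi makes A ⊗ B a left
   A-module. The second component of the multiplication is this action of S(A0)
   on S(A0) ⊗ A1 precomposed with μ ⊗ 1, so, μ being a monoid morphism, the
   monad laws in the second component reduce to the module laws; in the first
   component they are those of S. The squares for the multiplication and the
   unit are [D.4] and [D.3]. *)

Section SymmetricMonoidal.
Variable X : symmetric_monoidal_category.
Let L := smc_laws X.

Lemma tensm_merge (A B A' B' A'' B'' : X) (f' : hom A' A'') (f : hom A A')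
    (g' : hom B' B'') (g : hom B B') :
  (f' ⊠ g') ∘ (f ⊠ g) = (f' ∘ f) ⊠ (g' ∘ g).
Proof. by rewrite (tensm_comp L). Qed.

Lemma tensm_mergeA (E A B A' B' A'' B'' : X) (f' : hom A' A'') (f : hom A A')
    (g' : hom B' B'') (g : hom B B') (h : hom (A'' ⊗ B'') E) :
  h ∘ (f' ⊠ g') ∘ (f ⊠ g) = h ∘ ((f' ∘ f) ⊠ (g' ∘ g)).
Proof. by rewrite -compA tensm_merge. Qed.

Lemma associ_natural (A B E A' B' E' : X)
    (f : hom A A') (g : hom B B') (h : hom E E') :
  αi A' B' E' ∘ (f ⊠ (g ⊠ h)) = ((f ⊠ g) ⊠ h) ∘ αi A B E.
Proof.
rewrite -[LHS]compm1 -(associK L) -!compA [_ ∘ (α _ _ _ ∘ _)]compA.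
by rewrite -(assoc_natural L) !compA (assocK L) comp1m.
Qed.

Lemma luniti_natural (A B : X) (f : hom A B) :
  λui B ∘ f = (idm (II X) ⊠ f) ∘ λui A.
Proof.
rewrite -[LHS]compm1 -(lunitiK L) -!compA [f ∘ (_ ∘ _)]compA.
by rewrite -(lunit_natural L) !compA (lunitK L) comp1m.
Qed.

Lemma comp_assoc_inj (A B E F : X) (f g : hom (A ⊗ (B ⊗ E)) F) :
  f ∘ α A B E = g ∘ α A B E -> f = g.
Proof.
by move=> H; rewrite -[f]compm1 -[g]compm1 -(associK L) !compA H.
Qed.

(** As [λu] is a natural isomorphism, tensoring with the unit is isomorphic to the identity functor,
    hence faithful. *)
Lemma tensm_unit_inj (A B : X) (f g : hom A B) :
  idm (II X) ⊠ f = idm (II X) ⊠ g -> f = g.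
Proof.
move=> H; rewrite -[f]compm1 -[g]compm1 -(lunitiK L) !compA.
by rewrite -!(lunit_natural L) H.
Qed.

(* Kelly's redundancy of the left-unit coherence: by [tensm_unit_inj] it may be
   checked after tensoring with the unit, where pentagon and triangle give it. *)
Lemma lunit_tens (A B : X) :
  λu (A ⊗ B) ∘ α (II X) A B = λu A ⊠ idm B.
Proof.
apply: tensm_unit_inj; apply: comp_assoc_inj.
(* Precomposing with the invertible [α ⊠ idm B] completes the three-map side of the pentagon on
   [II X], [II X], [A], [B]. *)
have cancel (F : X) (f g : hom (((II X) ⊗ ((II X) ⊗ A)) ⊗ B) F) :
    f ∘ (α (II X) (II X) A ⊠ idm B) = g ∘ (α (II X) (II X) A ⊠ idm B) -> f = g.
  move=> H; rewrite -[f]compm1 -[g]compm1 -(tensm_id L) -(associK L).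
  by rewrite -[idm B]compm1 -tensm_merge !compA H.
apply: cancel.
transitivity (idm (II X) ⊠ λu (A ⊗ B) ∘ (idm (II X) ⊠ α (II X) A B
   ∘ α (II X) ((II X) ⊗ A) B ∘ (α (II X) (II X) A ⊠ idm B))).
  by rewrite !compA tensm_merge comp1m.
rewrite -(pentagon L) compA (triangle L) -(tensm_id L A B).
rewrite -(assoc_natural L) -(triangle L) -(assoc_natural L) -compA.
by rewrite tensm_merge comp1m.
Qed.

(** Cancelling the two outer inverse associators on the right leaves the pentagon. *)
Lemma pentagon_inv (A B E F : X) :
  (α A B E ⊠ idm F) ∘ αi (A ⊗ B) E F ∘ αi A B (E ⊗ F)
  = αi A (B ⊗ E) F ∘ (idm A ⊠ αi B E F).
Proof.
do 2!apply: comp_assoc_inj.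
rewrite -(compA _ (αi _ _ _) (α _ _ _)) (assocK L) compm1.
rewrite -(compA _ (αi _ _ _) (α _ _ _)) (assocK L) compm1.
rewrite -!compA (pentagon L) !compA tensm_mergeA (assocK L) comp1m (tensm_id L).
by rewrite compm1 (assocK L) comp1m.
Qed.

Definition free_action (A : X) (m : hom (A ⊗ A) A) (B : X) :
    hom (A ⊗ (A ⊗ B)) (A ⊗ B) :=
  (m ⊠ idm B) ∘ αi A A B.

(** Multiplicative maps are equivariant. Taking [f] an identity serves the square of the
    multiplication, taking [f] in the image of [S1] its naturality. *)
Lemma free_action_natural (A A' B B' : X) (m : hom (A ⊗ A) A)
    (m' : hom (A' ⊗ A') A') (f : hom A A') (g : hom B B') :
  f ∘ m = m' ∘ (f ⊠ f) ->
  (f ⊠ g) ∘ free_action m B = free_action m' B' ∘ (f ⊠ (f ⊠ g)).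
Proof.
move=> fm; rewrite /free_action -compA associ_natural !compA !tensm_merge.
by rewrite fm comp1m compm1.
Qed.

Section FreeModule.
Variables (A : X) (m : hom (A ⊗ A) A) (u : hom (II X) A).
Hypothesis mon : is_commutative_monoid m u.
Variable B : X.

(** Associativity of [m] leaves two rebracketings of [A ⊗ (A ⊗ (A ⊗ B))], which agree by
    [pentagon_inv]. *)
Lemma free_action_assoc :
  free_action m B ∘ (idm A ⊠ free_action m B)
  = free_action m B ∘ (m ⊠ idm (A ⊗ B)) ∘ αi A A (A ⊗ B).
Proof.
have -> : idm A ⊠ free_action m B
    = (idm A ⊠ (m ⊠ idm B)) ∘ (idm A ⊠ αi A A B).
  by rewrite tensm_merge comp1m.
rewrite /free_action !compA -(tensm_id L) -!(compA _ (αi _ _ _) (_ ⊠ _)).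
rewrite !associ_natural !compA !tensm_merge (monoid_assoc mon) comp1m.
rewrite -[in RHS](comp1m (idm B)) -tensm_merge -!compA; congr (_ ∘ _).
by rewrite compA pentagon_inv.
Qed.

(** The left unit law of [m] leaves [λu A ⊠ idm B], which [lunit_tens] relates to the unitor of
    [A ⊗ B]. *)
Lemma free_action_unitl :
  free_action m B ∘ ((u ⊠ idm (A ⊗ B)) ∘ λui (A ⊗ B)) = idm (A ⊗ B).
Proof.
rewrite /free_action compA -(tensm_id L) -(compA _ (αi _ _ _)) associ_natural.
rewrite compA tensm_merge (monoid_unitl mon) comp1m -lunit_tens.
by rewrite -(compA (λu _)) (associK L) compm1 (lunitiK L) (tensm_id L).
Qed.

(** Here the unit enters the middle factor: this is the right unit law of the monad [A ⊗ -],
    obtained from that of [m] and the triangle. *)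
Lemma free_action_unitr :
  free_action m B ∘ (idm A ⊠ ((u ⊠ idm B) ∘ λui B)) = idm (A ⊗ B).
Proof.
rewrite -[X in X ⊠ (_ ∘ _)](comp1m (idm A)) -tensm_merge /free_action.
rewrite compA -(compA _ (αi _ _ _)) associ_natural.
rewrite compA tensm_merge (monoid_unitr mon) comp1m -(triangle L).
rewrite -(compA (idm A ⊠ λu _)) (associK L) compm1 tensm_merge (lunitiK L).
by rewrite comp1m (tensm_id L).
Qed.

End FreeModule.
End SymmetricMonoidal.

Section ArrowMonad.
Variables (X : additive_smc) (S : differential_modality X).
Let L := smc_laws X.
Let D := dS_deriving S.

Lemma mubar_snd (φ : Arr X) :
  (mubar S φ).2
  = free_action (mS S (adom φ)) (acod φ) ∘ (muS S (adom φ) ⊠ idm _).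
Proof. by rewrite /= (tensm_id L). Qed.

Lemma Sbar_map_square (φ ψ : Arr X) (f : hom φ ψ) : is_square (Sbar_map S f).
Proof.
rewrite /is_square /= compA tensm_merge compm1 (asquare f) -compA.
by rewrite (deriving_natural D) compA tensm_merge comp1m.
Qed.

Lemma mubar_square (φ : Arr X) : is_square (mubar S φ).
Proof.
rewrite /is_square mubar_snd /= -[RHS]compA (deriving_chain D).
rewrite -/(free_action _ _) [LHS]compA [RHS]compA [X in _ = X ∘ _]compA.
(* [φ] touches only the free factor, so it commutes with the action. *)
rewrite (free_action_natural (m' := mS S (adom φ))).
  by rewrite !tensm_mergeA !comp1m !compm1.
by rewrite comp1m (tensm_id L) compm1.
Qed.

Lemma etabar_square (φ : Arr X) : is_square (etabar S φ).
Proof.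
rewrite /is_square /= -!compA (deriving_linear D) luniti_natural !compA.
by rewrite !tensm_merge !comp1m !compm1.
Qed.

End ArrowMonad.

(* The existentials range over proofs that the given pairs are maps of the
   arrow category. *)
Theorem proposition4p5 (X : additive_smc) (S : differential_modality X) :
  exists (map_sq : forall (φ ψ : Arr X) (f : hom φ ψ), is_square (Sbar_map S f))
         (mu_sq : forall φ : Arr X, is_square (mubar S φ))
         (eta_sq : forall φ : Arr X, is_square (etabar S φ)),
    @is_monad (Arr X) (Sbar S)
      (fun φ ψ f => ArrowHom (map_sq φ ψ f))
      (fun φ => ArrowHom (mu_sq φ))
      (fun φ => ArrowHom (eta_sq φ)).
Proof.
exists (@Sbar_map_square X S), (@mubar_square X S), (@etabar_square X S).
have L := smc_laws X; have T := S_monad S.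
have [F1 FM] := monad_functor T.
split.
- split=> [φ|φ ψ χ g f]; apply: arrow_hom_eq; rewrite /= /Sbar_map /=.
  + by rewrite F1 (tensm_id L).
  + by rewrite FM (tensm_comp L).
- move=> φ ψ f; apply: arrow_hom_eq; congr pair;
    first exact: (monad_mu_natural T).
  rewrite !mubar_snd /= -compA tensm_merge (monad_mu_natural T) comp1m.
  rewrite compA (free_action_natural (m' := mS S (adom ψ))).
    by rewrite -compA tensm_merge compm1.
  (* Naturality of [mS] makes [S1 S f.1] multiplicative. *)
  by rewrite (mS_natural S).
- move=> φ ψ f; apply: arrow_hom_eq; congr pair;
    first exact: (monad_eta_natural T).
  rewrite /= -compA luniti_natural !compA !tensm_merge.
  by rewrite comp1m !compm1 -(uS_natural S) compm1.
- move=> φ; apply: arrow_hom_eq; congr pair; first exact: (monad_assoc T).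
  have [muM _] := muS_morphism S (adom φ).
  transitivity (free_action (mS S (adom φ)) (acod φ)
      ∘ (muS S (adom φ) ⊠ idm _)
      ∘ (S1 S (muS S (adom φ)) ⊠ (free_action (mS S (adom φ)) (acod φ)
           ∘ (muS S (adom φ) ⊠ idm _)))).
    by rewrite -!mubar_snd.
  rewrite -compA tensm_merge (monad_assoc T) comp1m.
  (* Splitting off [idm ⊠ free_action] exposes two nested actions for module associativity. *)
  rewrite -[muS S _ ∘ muS S _]comp1m -tensm_merge compA.
  rewrite (free_action_assoc (S_monoid S _)) -compA associ_natural.
  transitivity (free_action (mS S (adom φ)) (acod φ)
      ∘ (muS S (adom φ) ⊠ idm _)
      ∘ (free_action (mS S (S (adom φ))) (S (adom φ) ⊗ acod φ)
          ∘ (muS S (S (adom φ)) ⊠ idm _)));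
    last by rewrite /= !(tensm_id L).
  (* Once the common outer action is stripped, what remains is that [muS] preserves
     multiplication. *)
  rewrite -[LHS]compA -[RHS]compA; congr (_ ∘ _).
  rewrite /free_action -(tensm_id L (S (S _)) (_ ⊗ _)).
  rewrite -(compA _ (αi _ _ _)) associ_natural.
  by rewrite !compA !tensm_merge muM -compA tensm_merge !comp1m compm1.
- move=> φ; apply: arrow_hom_eq; congr pair; first exact: (monad_unitl T).
  have [_ muU] := muS_morphism S (adom φ).
  rewrite mubar_snd /= -compA [(_ ⊠ _) ∘ (_ ∘ _)]compA tensm_merge muU comp1m.
  exact: free_action_unitl (S_monoid S _) _.
- move=> φ; apply: arrow_hom_eq; congr pair; first exact: (monad_unitr T).
  rewrite mubar_snd /= -compA tensm_merge (monad_unitr T) comp1m.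
  exact: free_action_unitr (S_monoid S _) _.
Qed.
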